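(* Let $n$ be sufficiently large. In the $(1:1)$ WMaker--WBreaker Hamilton cycle game on $E(K_n)$ (with WBreaker making the first move), WMaker has a strategy to win in at most $n+6$ moves, i.e. to ensure that after at most $n+6$ of her own moves her claimed edges contain a Hamilton cycle of $K_n$.
   Context: The $(1:1)$ WMaker--WBreaker game on $E(K_n)$: two players, WMaker and WBreaker, alternately claim one edge of the complete graph $K_n$ per turn. Both players are walkers: at her/his first move a player chooses any vertex as starting position; when a player is positioned at a vertex $v$, she/he may only claim an edge incident with $v$ that has not previously been claimed by the opponent, and the other endpoint of the claimed edge becomes her/his new position. Unless stated otherwise WBreaker starts, so a round consists of a move of WBreaker followed by a move of WMaker. In the Hamilton cycle game WMaker wins once her claimed edges contain the edge set of a Hamilton cycle of $K_n$. *)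

(* Defs.v *)
From mathcomp Require Import all_boot.

Set Implicit Arguments.
Unset Strict Implicit.
Unset Printing Implicit Defensive.

(* The board is E(K_n), with vertex set 'I_n and edges the 2-element subsets  *)
(* of 'I_n.  A move is an ordered pair (u, v): the player stands at u, claims *)
(* the edge {u, v} and stands at v afterwards.                                *)
Definition move (n : nat) : Type := ('I_n * 'I_n)%type.

Definition edge n (d : move n) : {set 'I_n} := [set d.1; d.2].

(* In chronological order. *)
Definition moves (n : nat) : Type := seq (move n).

Definition claimed n (w : moves n) : {set {set 'I_n}} := [set edge d | d in w].

(* None before the player's first move. *)
Definition position n (w : moves n) : option 'I_n :=
  ohead (rev [seq d.2 | d <- w]).

(* Legality of d for a player whose past moves are own, against an opponent   *)
(* whose past moves are opp.  The starting vertex is free and is chosen as    *)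
(* part of the first move, which already claims an edge.  Only edges of the   *)
(* opponent are forbidden: walking again along one's own edge is a legal      *)
(* move, and it counts as a move.  Hence a player who has already moved is    *)
(* never blocked, since the last edge can be walked back.                     *)
Definition legal n (own opp : moves n) (d : move n) : bool :=
  [&& if position own is Some v then d.1 == v else true,
      d.1 != d.2
    & edge d \notin claimed opp].

(* A WMaker strategy: S bs ms is WMaker's next move when bs and ms are the    *)
(* moves made so far by WBreaker and by WMaker, respectively.                 *)
Definition strategy (n : nat) : Type := moves n -> moves n -> move n.

(* consistent S bs ms: after some number of complete rounds, each opened by   *)
(* an arbitrary legal move of WBreaker and closed by the answer of S, the     *)
(* moves of WBreaker and of WMaker are bs and ms.                             *)
Inductive consistent n (S : strategy n) : moves n -> moves n -> Prop :=
| consistent_start : consistent S [::] [::]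
| consistent_round bs ms b :
    consistent S bs ms -> legal bs ms b ->
    consistent S (rcons bs b) (rcons ms (S (rcons bs b) ms)).

Definition legal_strategy n (S : strategy n) : Prop :=
  forall bs ms b, consistent S bs ms -> legal bs ms b ->
    legal ms (rcons bs b) (S (rcons bs b) ms).

Definition contains_hamilton_cycle n (E : {set {set 'I_n}}) : Prop :=
  exists c : seq 'I_n,
    [/\ 2 < size c, uniq c, forall v : 'I_n, v \in c
      & cycle (fun u v => [set u; v] \in E) c].

(* Whatever WBreaker does, WMaker has won after some k <= t of her moves.     *)
(* Plays of t rounds always exist when n > 2, as no player is ever blocked;   *)
(* moves made after WMaker has won are immaterial.                            *)
Definition wins_within n (S : strategy n) (t : nat) : Prop :=
  forall bs ms, consistent S bs ms -> size ms = t ->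
    exists2 k, k <= t & contains_hamilton_cycle (claimed (take k ms)).

(* Main.v *)
(* Write M for WMaker and B for WBreaker.  After a few moves M closes a cycle     *)
(* through her starting vertex c and walks on from c.  Her graph is then a        *)
(* lollipop: from her position v, Hamilton paths of the visited vertices lead to  *)
(* both neighbours s1 and s2 of c on the cycle, and this persists whenever she    *)
(* moves to an unvisited vertex.  As B is a walker, M can keep the set U of       *)
(* unvisited vertices free of edges of B, by moving to an end of every edge that  *)
(* B claims inside U, and can keep all but one vertex of U free of edges of B to  *)
(* s1 and s2.  Therefore, when a single vertex w is left, B cannot block both     *)
(* edges from v to s1 and s2, and M closes a cycle through all vertices but w     *)
(* with her n-th move.                                                            *)
(*   Six moves remain to insert w.  If B stands at w, M waits for one move.  Then *)
(* she jumps to a vertex q of the cycle and goes to w, to another vertex f of the *)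
(* cycle, and closes up with the edge joining the successors or the edge joining  *)
(* the predecessors of q and f; B cannot stop both.  Suitable q and f exist since *)
(* a walk with t edges leaves at most about 2t/3 vertices adjacent to a given set *)
(* of vertices.                                                                   *)

Require Import Defs.
From mathcomp Require Import all_boot.
From mathcomp Require Import zify.
From Stdlib Require Import ClassicalEpsilon.

Set Implicit Arguments.
Unset Strict Implicit.
Unset Printing Implicit Defensive.

Definition add_edge (T : Type) (E : T -> T -> Prop) (x y a b : T) : Prop :=
  E a b \/ (a = x /\ b = y) \/ (a = y /\ b = x).

Section Lollipop.

Variables (T : finType) (s1 s2 : T).
Hypothesis s12 : s1 <> s2.
Implicit Types (E : T -> T -> Prop) (U D : {set T}) (x y v r z : T).

(* In this section E is the graph of WBreaker, x his position, v the position of  *)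
(* WMaker, U the set of unvisited vertices, and s1, s2 are the other ends of her  *)
(* two Hamilton paths; WBreaker is to move.                                       *)
Definition is_end (s : T) : Prop := s = s1 \/ s = s2.

Definition closable E x v : Prop :=
  (~ E v s1 /\ ~ E v s2) \/ (exists s, [/\ is_end s, ~ E v s, x <> v & x <> s]).

(* WMaker visits k of the vertices of U and then closes a cycle.  WBreaker may    *)
(* even walk along her edges.                                                     *)
Fixpoint force k E x v U : Prop :=
  if k is k'.+1 then forall y, y <> x ->
    exists r, [/\ r \in U, ~ add_edge E x y v r & force k' (add_edge E x y) y r (U :\ r)]
  else closable E x v.

Definition win E x v U : Prop := force #|U|.-1 E x v U.

Lemma win_step E x v U : 1 < #|U| ->
  (forall y, y <> x ->
    exists r, [/\ r \in U, ~ add_edge E x y v r & win (add_edge E x y) y r (U :\ r)]) ->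
  win E x v U.
Proof.
rewrite /win; case def_k: #|U| => [|[|k]] //= _ step y /step[r [rU vr]].
have [<-] : k.+2 = #|U :\ r|.+1 by rewrite -def_k (cardsD1 r) rU.
by exists r.
Qed.

Record frame v U : Prop := Frame {
  frame_v : v \notin U;
  frame_vs : ~ is_end v;
  frame_sU : forall s, is_end s -> s \notin U }.

(* D contains the dirty vertices, those joined to s1 or s2 by WBreaker.           *)
Record inv E v U D : Prop := Inv {
  inv_sym : forall a b, E a b -> E b a;
  inv_frame : frame v U;
  inv_UU : forall a b, a \in U -> b \in U -> ~ E a b;
  inv_dirt : forall u s, u \in U -> is_end s -> E u s -> u \in D;
  inv_DU : forall d, d \in D -> d \in U }.

Definition unblocked E v U : Prop := forall u, u \in U -> ~ E v u.

(* If z is the only vertex of U blocked from v and WBreaker stands at v or z, then *)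
(* any further edge in U that he claims has an end that WMaker can move to.        *)
Definition near E x v U z : Prop :=
  (forall u, u \in U -> E v u -> u = z) /\ (x = v \/ x = z).

Lemma add_sym E x y : (forall a b, E a b -> E b a) ->
  forall a b, add_edge E x y a b -> add_edge E x y b a.
Proof. by rewrite /add_edge => symE a b; intuition. Qed.

Lemma frame_move v U r : frame v U -> r \in U -> frame r (U :\ r).
Proof.
move=> [_ _ sU] rU; split; first by rewrite !inE eqxx.
  by move=> /sU; rewrite rU.
by move=> s /sU; rewrite !inE => /negPf->; rewrite andbF.
Qed.

Lemma free_move E x y v U D D' r : inv E v U D -> y <> x -> r \in U ->
  ~ (x \in U /\ y \in U) ->
  (forall d, d \in D' -> d \in U /\ d <> r) ->
  (forall u, u \in D -> u <> r -> u \in D') ->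
  (forall u s, u \in U -> is_end s -> u <> r ->
     (u = x /\ s = y) \/ (u = y /\ s = x) -> u \in D') ->
  inv (add_edge E x y) r (U :\ r) D' /\ unblocked (add_edge E x y) r (U :\ r).
Proof.
move=> [symE fr UU dirt DU] yx rU xyU D'U DD' eD'; split; last first.
  move=> u; rewrite !inE => /andP[/eqP ur uU] [/UU|[[? ?]|[? ?]]]; subst; tauto.
split.
- exact: add_sym.
- exact: frame_move fr rU.
- move=> a b; rewrite !inE => /andP[_ aU] /andP[_ bU] [/UU|[[? ?]|[? ?]]]; subst; tauto.
- move=> u s; rewrite !inE => /andP[/eqP ur uU] es [/dirt|]; first by auto.
  by move=> [[? ?]|[? ?]]; apply: (eD' u s); auto.
- by move=> d /D'U[dU /eqP]; rewrite !inE dU => ->.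
Qed.

Lemma inner_move E x y v U D r : inv E v U D -> y <> x -> x \in U -> y \in U ->
  r = x \/ r = y ->
  inv (add_edge E x y) r (U :\ r) (D :\ r) /\
  (forall u, u \in U :\ r -> add_edge E x y r u -> u = x \/ u = y).
Proof.
move=> [symE fr UU dirt DU] yx xU yU rxy.
have rU : r \in U by case: rxy => ->.
split; last first.
  by move=> u; rewrite !inE => /andP[/eqP ur uU] [/UU|[[? ?]|[? ?]]]; subst; tauto.
split.
- exact: add_sym.
- exact: frame_move fr rU.
- move=> a b; rewrite !inE => /andP[/eqP ar aU] /andP[/eqP br bU] [/UU|e]; first tauto.
  by case: rxy => ?; intuition congruence.
- move=> u s; rewrite !inE => /andP[/eqP ur uU] es [e|].
    by rewrite (dirt u s) // andbT; apply/eqP.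
  by move=> [[? ?]|[? ?]]; subst; have:= frame_sU fr es; rewrite ?xU ?yU.
- by move=> d; rewrite !inE => /andP[-> /DU].
Qed.

Lemma win1 E x v U : #|U| <= 1 -> closable E x v -> win E x v U.
Proof. by rewrite /win; move: #|U| => [|[]]. Qed.

Lemma card_rem r U : r \in U -> #|U :\ r| = #|U|.-1.
Proof. by move=> rU; rewrite (cardsD1 r U) rU. Qed.

Lemma end1 : is_end s1. Proof. by left. Qed.
Lemma end2 : is_end s2. Proof. by right. Qed.

Lemma frame_not_end v U u : frame v U -> u \in U -> ~ is_end u.
Proof. by move=> fr uU /(frame_sU fr); rewrite uU. Qed.

Lemma pick_notin U (A : {set T}) : #|A| < #|U| -> exists2 r, r \in U & r \notin A.
Proof.
move=> AU; have /subsetPn[r rU rA] : ~~ (U \subset A).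
  by apply: contraL AU => /subset_leq_card; rewrite -leqNgt.
by exists r.
Qed.

Lemma pick_neq2 U a b : 2 < #|U| -> exists r, [/\ r \in U, r <> a & r <> b].
Proof.
move=> U3; have [|r rU] := @pick_notin U [set a; b].
  by apply: leq_ltn_trans U3; rewrite cards2; case: eqP.
by rewrite !inE negb_or => /andP[/eqP ra /eqP rb]; exists r.
Qed.

Lemma end_neq U v : frame v U ->
  [/\ v <> s1, v <> s2 & forall a, a \in U -> [/\ a <> v, a <> s1 & a <> s2]].
Proof.
move=> [/negP vU vs sU]; split=> [?|?|a aU].
- by apply: vs; subst; left.
- by apply: vs; subst; right.
- split=> ?; subst a; first exact: vU.
    by move: (sU _ end1); rewrite aU.
  by move: (sU _ end2); rewrite aU.
Qed.

Ltac new_edge := rewrite /add_edge; intuition (subst; tauto || congruence).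

Lemma win2_two E x v U a b : frame v U -> #|U| = 2 ->
  a \in U -> b \in U -> a <> b -> unblocked E v U ->
  (forall s, is_end s -> ~ E a s) -> (exists2 s, is_end s & ~ E b s) ->
  win E x v U.
Proof.
move=> fr U2 aU bU ab clv aS [s es bs].
have [v1 v2 nU] := end_neq fr; have [av a1 a2] := nU _ aU; have [bv b1 b2] := nU _ bU.
have [as1 as2] := (aS _ end1, aS _ end2); have [va vb] := (clv _ aU, clv _ bU).
have U1 r : r \in U -> #|U :\ r| <= 1 by move/card_rem->; rewrite U2.
have [sv sa sb] : [/\ s <> v, s <> a & s <> b] by case: es => ->; split; auto.
apply: win_step => [|y yx]; first by rewrite U2.
have [ya|ya] := eqVneq y a.
  subst y; exists b; split=> //; first by new_edge.
  by apply: win1; [exact: U1|right; exists s; split=> //; new_edge].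
have [xa|xa] := eqVneq x a; last first.
  move/eqP in ya; move/eqP in xa.
  exists a; split=> //; first by new_edge.
  by apply: win1; [exact: U1|left; split; new_edge].
subst x; move/eqP in ya.
have [yv|/eqP yv] := eqVneq y v.
  subst y; exists b; split=> //; first by new_edge.
  by apply: win1; [exact: U1|right; exists s; split=> //; new_edge].
exists a; split=> //; first by new_edge.
apply: win1; [exact: U1|right].
have [y1|/eqP y1] := eqVneq y s1.
  by exists s2; split=> //; [right|new_edge|congruence].
by exists s1; split=> //; [left|new_edge].
Qed.

Lemma win2_far E x v U a : frame v U -> #|U| = 2 ->
  a \in U -> ~ E v a -> (forall s, is_end s -> ~ E a s) ->
  x <> v -> x <> a -> ~ is_end x -> win E x v U.
Proof.
move=> fr U2 aU va aS xv xa xS.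
have [v1 v2 nU] := end_neq fr; have [av a1 a2] := nU _ aU.
have [as1 as2] := (aS _ end1, aS _ end2).
have [x1 x2] : x <> s1 /\ x <> s2 by split=> ?; subst; apply: xS; [left|right].
apply: win_step => [|y yx]; first by rewrite U2.
exists a; split=> //; first by new_edge.
by apply: win1; [rewrite card_rem // U2|left; split; new_edge].
Qed.

Lemma near_move E x y v U z r : v \notin U -> near E x v U z -> y <> x ->
  r \in U -> r <> z -> r <> y -> ~ add_edge E x y v r /\ r <> x.
Proof.
move=> /negP vU [Nz xz] yx rU rz ry.
have rx : r <> x by case: xz => ->; congruence.
split=> // -[/(Nz _ rU)|]; intuition congruence.
Qed.

Lemma unblocked_near E x v U : unblocked E v U -> near E x v U x.
Proof. by move=> cl; split; [move=> u /cl|right]. Qed.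

Lemma two_in U : #|U| = 2 -> exists a b, [/\ a \in U, b \in U & a <> b].
Proof.
move/eqP/cards2P => [a [b [/eqP ab ->]]].
by exists a, b; rewrite !inE !eqxx orbT.
Qed.

Lemma unblocked_add E x y r U D v : inv E v U D -> r \in U ->
  ~ (x \in U /\ y \in U) \/ (r <> x /\ r <> y) ->
  unblocked (add_edge E x y) r (U :\ r).
Proof.
move=> iE rU rxy u; rewrite inE => /andP[_ uU] [/(inv_UU iE)|]; [tauto|].
by move=> [[? ?]|[? ?]]; subst; intuition.
Qed.

Lemma free_end E x y v U D a : inv E v U D -> a \in U -> a \notin D ->
  exists2 s, is_end s & ~ add_edge E x y a s.
Proof.
move=> iE aU /negP aD.
have [_ _ nU] := end_neq (inv_frame iE); have [av a1 a2] := nU _ aU.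
have [E1 E2] : ~ E a s1 /\ ~ E a s2.
  by split=> /(inv_dirt iE aU); [move/(_ end1)|move/(_ end2)].
have [x1|/eqP x1] := eqVneq x s1.
  by exists s2; [right|new_edge].
have [y1|/eqP y1] := eqVneq y s1.
  by exists s2; [right|new_edge].
by exists s1; [left|new_edge].
Qed.

Lemma win2_after E x y v r U D : inv E v U D -> y <> x -> r \in U -> #|U| = 3 ->
  ~ (x \in U /\ y \in U) \/ (r <> x /\ r <> y) -> (forall d, d \in D -> d = r) ->
  win (add_edge E x y) y r (U :\ r).
Proof.
move=> iE yx rU U3 rxy Dr.
have cl := unblocked_add iE rU rxy.
have U2 : #|U :\ r| = 2 by rewrite card_rem ?U3.
have [a [b [aU' bU' ab]]] := two_in U2.
have fr := frame_move (inv_frame iE) rU.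
have nD c : c \in U :\ r -> c \in U /\ c \notin D.
  rewrite !inE => /andP[/eqP cr cU]; split=> //.
  by apply/negP => /Dr.
have [_ _ nU] := end_neq (inv_frame iE).
wlog: a b aU' bU' ab / a <> x /\ a <> y => [wl|[ax ay]].
  have [bxy|bxy] := boolP ((b == x) || (b == y)); last first.
    move: bxy; rewrite negb_or => /andP[/eqP bx /eqP by'].
    by apply: (wl b a) => //; congruence.
  have [axy|axy] := boolP ((a == x) || (a == y)); last first.
    move: axy; rewrite negb_or => /andP[/eqP ax /eqP ay].
    by apply: (wl a b).
  have [s es bs] : exists2 s, is_end s & ~ add_edge E x y b s.
    by have [bU bD] := nD _ bU'; apply: (free_end x y iE bU bD).
  apply: (win2_two y fr U2 aU' bU' ab cl); last by exists s.
  have [aU /negP aD] := nD _ aU'; have [bU bD] := nD _ bU'.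
  have [a1 a2 av] := nU _ aU; have [b1 b2 bv] := nU _ bU.
  move=> t et [/(inv_dirt iE aU)|]; first tauto.
  by move: axy bxy => /orP[] /eqP ? /orP[] /eqP ?; case: et => ->; intuition congruence.
have [aU /negP aD] := nD _ aU'; have [bU bD] := nD _ bU'.
have [s es bs] := free_end x y iE bU bD.
apply: (win2_two y fr U2 aU' bU' ab cl); last by exists s.
move=> t et [/(inv_dirt iE aU)|]; first tauto.
by intuition congruence.
Qed.

Definition good E x v U D : Prop :=
  inv E v U D /\ (unblocked E v U \/ exists2 z, near E x v U z & z \notin D).

Lemma good_near E x v U D : good E x v U D -> exists z, near E x v U z.
Proof. by move=> [_ [/unblocked_near|[z nz _]]]; [exists x|exists z]. Qed.

Lemma good_dirty E x v U D d : good E x v U D -> d \in D -> ~ E v d.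
Proof.
move=> [iE [cl|[z [Nz _] zD]]] dD; have dU := inv_DU iE dD; first exact: cl.
by move=> /(Nz _ dU) ?; subst z; rewrite dD in zD.
Qed.

Lemma win3 E x v U D : good E x v U D -> #|D| <= 1 -> #|U| = 3 -> win E x v U.
Proof.
move=> gE D1 U3; have [iE _] := gE; have [z nz] := good_near gE.
have fr := inv_frame iE; have vU := frame_v fr; have vU' := negP vU.
have [v1 v2 nU] := end_neq fr.
have nend u (uU : u \in U) := frame_not_end fr uU.
have U3' : 2 < #|U| by rewrite U3.
apply: win_step => [|y yx]; first by rewrite U3.
have [D0|[d dD]] := set_0Vmem D.
  have [r [rU rz ry]] := pick_neq2 z y U3'.
  have [vr rx] := near_move vU nz yx rU rz ry.
  exists r; split=> //; apply: (win2_after iE) => //; first by right.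
  by move=> d; rewrite D0 inE.
have D_d e : e \in D -> e = d by move=> eD; apply: (card_le1_eqP D1).
have dU := inv_DU iE dD; have vd := good_dirty gE dD.
have clean u : u \in U -> u <> d -> forall s, is_end s -> ~ E u s.
  by move=> uU ud s es /(inv_dirt iE uU es)/D_d.
have U2 r : r \in U -> #|U :\ r| = 2 by move/card_rem->; rewrite U3.
have inr u r : u \in U -> u <> r -> u \in U :\ r.
  by rewrite !inE => -> /eqP->.
have [dy|/eqP dy] := eqVneq d y.
  subst y; have [xU|/negP xU] := boolP (x \in U).
    have zx : z = x by case: nz => _ [] // ?; subst; rewrite xU in vU.
    have [r [rU rx rd]] := pick_neq2 x d U3'; subst z.
    have [vr _] := near_move vU nz yx rU rx rd.
    exists r; split=> //.
    apply: (@win2_far _ _ _ _ x (frame_move fr rU) (U2 _ rU)); auto.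
      by move=> [/(inv_UU iE rU)|]; [tauto|intuition congruence].
    move=> s es [|]; first by apply: (clean x); auto.
    by have := nend _ dU; intuition (subst; tauto).
  have [xv|/eqP xv] := eqVneq x v.
    have [r [rU rz rd]] := pick_neq2 z d U3'.
    have [vr rx] := near_move vU nz yx rU rz rd.
    have [u [uU ur ud]] := pick_neq2 r d U3'.
    exists r; split=> //.
    apply: (@win2_far _ _ _ _ u (frame_move fr rU) (U2 _ rU)); auto.
      by move=> [/(inv_UU iE rU)|]; [tauto|intuition congruence].
    move=> s es [|]; first exact: (clean u).
    by intuition (subst; tauto).
  exists d; split=> //; first by move=> [|]; intuition congruence.
  by apply: (win2_after iE); auto; left; tauto.
have [dx|/eqP dx] := eqVneq d x; last first.
  exists d; split=> //; first by move=> [|]; intuition congruence.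
  by apply: (win2_after iE); auto.
subst x; have cl : unblocked E v U.
  by case: gE => _ [] // [t [_ []] ? /negP]; subst; rewrite ?dD // in vU'.
have [yU|/negP yU] := boolP (y \in U).
  have [u [uU ud uy]] := pick_neq2 d y U3'.
  exists d; split=> //; first by move=> [|]; intuition congruence.
  apply: (@win2_far _ _ _ _ u (frame_move fr dU) (U2 _ dU)); auto.
    by move=> [/(inv_UU iE dU)|]; [tauto|intuition congruence].
  move=> s es [|]; first exact: (clean u).
  by intuition (subst; tauto).
have [yv|/eqP yv] := eqVneq y v.
  subst y; have [r [rU rd _]] := pick_neq2 d d U3'.
  have [u [uU ur ud]] := pick_neq2 r d U3'.
  exists r; split=> //.
    by move=> [/cl|]; intuition congruence.
  apply: (@win2_far _ _ _ _ u (frame_move fr rU) (U2 _ rU)); auto.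
  - by move=> [/(inv_UU iE rU)|]; [tauto|intuition (subst; tauto)].
  - move=> s es [|]; first exact: (clean u).
    by intuition (subst; tauto).
  - by move=> ?; subst.
  - by move=> ?; subst.
  - exact: frame_vs fr.
exists d; split=> //; first by move=> [|]; intuition congruence.
by apply: (win2_after iE); auto; left; tauto.
Qed.

Definition endb s := (s == s1) || (s == s2).

Lemma is_endP s : reflect (is_end s) (endb s).
Proof.
apply: (iffP orP); first by case=> /eqP->; [left|right].
by case=> ->; [left|right]; apply/eqP.
Qed.

Definition newdirt x y U : {set T} :=
  [set u in U | ((u == x) && endb y) || ((u == y) && endb x)].

Lemma newdirtP x y U u : u \in newdirt x y U ->
  u \in U /\ ((u = x /\ is_end y) \/ (u = y /\ is_end x)).
Proof.
rewrite inE => /andP[uU /orP[]] /andP[/eqP ? /is_endP]; split=> //; [left|right]; by [].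
Qed.

Lemma card_newdirt x y v U : frame v U -> #|newdirt x y U| <= 1.
Proof.
move=> fr; apply/card_le1_eqP => a b /newdirtP[aU ea] /newdirtP[bU eb].
by have [na nb] := (frame_not_end fr aU, frame_not_end fr bU); intuition (subst; tauto || congruence).
Qed.

Lemma free_step E x y v U D z r : inv E v U D -> near E x v U z -> y <> x ->
  ~ (x \in U /\ y \in U) -> r \in U -> r <> z -> r <> y ->
  let D' := (D :|: newdirt x y U) :\ r in
  [/\ ~ add_edge E x y v r, inv (add_edge E x y) r (U :\ r) D'
    & unblocked (add_edge E x y) r (U :\ r)].
Proof.
move=> iE nz yx xyU rU rz ry D'.
have [vr rx] := near_move (frame_v (inv_frame iE)) nz yx rU rz ry.
have [] // := @free_move _ _ _ _ _ _ D' _ iE yx rU xyU.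
- move=> d; rewrite !inE => /andP[/eqP dr /orP[/(inv_DU iE)|/andP[]]] //.
- by move=> u uD /eqP ur; rewrite !inE ur uD.
move=> u s uU /is_endP es /eqP ur; rewrite !inE ur uU /=.
by case=> [[-> <-]|[-> <-]]; rewrite eqxx es ?orbT.
Qed.

Lemma inner_step E x y v U D z : inv E v U D -> near E x v U z -> y <> x ->
  x \in U -> y \in U ->
  [/\ z = x, ~ add_edge E x y v y, inv (add_edge E x y) y (U :\ y) (D :\ y)
    & near (add_edge E x y) y y (U :\ y) x].
Proof.
move=> iE [Nz xz] yx xU yU; have /negP vU := frame_v (inv_frame iE).
have zx : z = x by case: xz => ?; subst.
have [iE' N'] := inner_move iE yx xU yU (or_intror erefl).
split=> //; first by move=> [/(Nz _ yU)|]; [congruence|intuition (subst; tauto)].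
split; last by left.
by move=> u uU /(N' _ uU)[] // uy; move: uU; rewrite uy !inE eqxx.
Qed.

Lemma inner_back E x y v U D : inv E v U D -> ~ E v x -> y <> x ->
  x \in U -> y \in U ->
  [/\ ~ add_edge E x y v x, inv (add_edge E x y) x (U :\ x) (D :\ x)
    & near (add_edge E x y) y x (U :\ x) y].
Proof.
move=> iE vx yx xU yU; have /negP vU := frame_v (inv_frame iE).
have [iE' N'] := inner_move iE yx xU yU (or_introl erefl).
split=> //; first by move=> [|]; intuition (subst; tauto).
split; last by right.
by move=> u uU /(N' _ uU)[] // ux; move: uU; rewrite ux !inE eqxx.
Qed.

Lemma free_step1 E x y v U D z : inv E v U D -> near E x v U z -> y <> x ->
  ~ (x \in U /\ y \in U) -> #|D| <= 1 -> 2 < #|U| ->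
  exists r D', [/\ r \in U, ~ add_edge E x y v r, inv (add_edge E x y) r (U :\ r) D',
    unblocked (add_edge E x y) r (U :\ r) & #|D'| <= 1].
Proof.
move=> iE nz yx xyU D1 U3.
have fr := inv_frame iE; have /negP vU := frame_v fr.
have [/existsP[d /and3P[dD /eqP dz /eqP dy]]|] :=
    boolP [exists d, [&& d \in D, d != z & d != y]].
  have dU := inv_DU iE dD.
  have [vd iE' cl] := free_step iE nz yx xyU dU dz dy.
  exists d, ((D :|: newdirt x y U) :\ d); split=> //.
  apply: leq_trans (card_newdirt x y fr); apply/subset_leq_card/subsetP => u.
  rewrite !in_setD1 in_setU => /andP[ud /orP[uD|//]].
  by rewrite (card_le1_eqP D1 _ _ uD dD) eqxx in ud.
rewrite negb_exists => /forallP noD.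
have [r [rU rz ry]] := pick_neq2 z y U3.
have [vr iE' cl] := free_step iE nz yx xyU rU rz ry.
exists r, ((D :|: newdirt x y U) :\ r); split=> //.
apply: leq_trans (subset_leq_card (subD1set _ _)) _.
have [->|[d dD]] := set_0Vmem D; first by rewrite set0U; apply: card_newdirt fr.
have /setUidPl-> // : newdirt x y U \subset D.
apply/subsetP => u /newdirtP[uU eu].
have dU := inv_DU iE dD; have nd := frame_not_end fr dU.
have nv := frame_vs fr.
have : d = z \/ d = y.
  by move: (noD d); rewrite dD /= negb_and !negbK => /orP[] /eqP ->; [left|right].
suff H : d = z \/ d = y -> u = d by move=> /H->.
by case: nz => _ [] ?; intuition (subst; tauto).
Qed.

Lemma good_win E x v U D : good E x v U D -> #|D| <= 1 -> 2 < #|U| -> win E x v U.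
Proof.
have [k] := ubnP #|U|; elim: k E x v U D => // k IH E x v U D Uk gE D1.
rewrite leq_eqVlt => /orP[/eqP/esym U3|U4]; first exact: win3 gE D1 U3.
have U3 := ltnW U4.
have IHr E' y r D' : r \in U -> good E' y r (U :\ r) D' -> #|D'| <= 1 ->
    win E' y r (U :\ r).
  by move=> rU gE' D1'; apply: IH gE' D1' _; rewrite card_rem //; lia.
have [iE _] := gE; have [z nz] := good_near gE.
apply: win_step => [|y yx]; first exact: ltnW.
have [/andP[xU yU]|/andP xyU] := boolP ((x \in U) && (y \in U)); last first.
  have [r [D' [rU vr iE' cl D1']]] := free_step1 iE nz yx xyU D1 U3.
  by exists r; split=> //; apply: (IHr _ _ _ D') => //; split; auto.
have [xD|xD] := boolP (x \in D); last first.
  have [_ vy iE' nx] := inner_step iE nz yx xU yU.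
  exists y; split=> //; apply: (IHr _ _ _ (D :\ y)) => //.
    by split=> //; right; exists x => //; rewrite !inE negb_and xD orbT.
  exact: leq_trans (subset_leq_card (subD1set _ _)) D1.
have [vx iE' nx] := inner_back iE (good_dirty gE xD) yx xU yU.
exists x; split=> //; apply: (IHr _ _ _ (D :\ x)) => //; last first.
  exact: leq_trans (subset_leq_card (subD1set _ _)) D1.
split=> //; right; exists y => //.
rewrite !inE negb_and; apply/orP; right; apply/negP => yD.
by apply: yx; apply: (card_le1_eqP D1).
Qed.

Lemma unblocked_good E x v U D : inv E v U D -> unblocked E v U -> good E x v U D.
Proof. by split; auto. Qed.

Lemma near_win1_at E v U D z : inv E v U D -> near E v v U z ->
  #|D| <= 1 -> 3 < #|U| -> win E v v U.
Proof.
move=> iE nz D1 U4; apply: win_step => [|y yv]; first by lia.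
have [|r [D' [rU vr iE' cl D1']]] := free_step1 iE nz yv _ D1 (ltnW U4).
  by rewrite (negPf (frame_v (inv_frame iE))) => -[].
exists r; split=> //; apply: good_win (unblocked_good _ iE' cl) D1' _.
by rewrite card_rem //; lia.
Qed.

Definition wins_upto m K := forall E x v U D z, inv E v U D -> near E x v U z ->
  #|D| <= m -> K <= #|U| -> win E x v U.

Lemma wins_upto1 : wins_upto 1 5.
Proof.
move=> E x v U D z iE nz D1 U5; apply: win_step => [|y yx]; first by lia.
have [/andP[xU yU]|/andP xyU] := boolP ((x \in U) && (y \in U)).
  have [_ vy iE' nx] := inner_step iE nz yx xU yU.
  exists y; split=> //; apply: near_win1_at iE' nx _ _.
    exact: leq_trans (subset_leq_card (subD1set _ _)) D1.
  by rewrite card_rem //; lia.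
have [|r [D' [rU vr iE' cl D1']]] := free_step1 iE nz yx xyU D1 _; first by lia.
exists r; split=> //; apply: good_win (unblocked_good _ iE' cl) D1' _.
by rewrite card_rem //; lia.
Qed.

(* To keep two dirty vertices unvisited, WBreaker has to shuttle between them     *)
(* through fresh vertices of U.  WMaker then moves to the dirty end of an edge    *)
(* from a dirty to a clean vertex of U, and visits a dirty vertex at least once   *)
(* in every four moves.                                                           *)
Section Reduce.

Variables (m K : nat).
Hypotheses (m_gt0 : 0 < m) (K_gt2 : 2 < K) (winsK : wins_upto m K).

Let win_small E x v U D z d : inv E v U (D :\ d) -> near E x v U z ->
  d \in D -> #|D| <= m.+1 -> K <= #|U| -> win E x v U.
Proof.
by move=> iE nz dD Dm; apply: winsK iE nz _; rewrite card_rem //; lia.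
Qed.

Let pick_dirty D a : m < #|D| -> exists2 d, d \in D & d <> a.
Proof.
move=> mD; have [|d dD] := @pick_notin D [set a]; first by rewrite cards1; lia.
by rewrite inE => /eqP; exists d.
Qed.

Let win_at_dirty E x v U D : inv E v U D -> unblocked E v U -> x \in D ->
  #|D| <= m.+1 -> K < #|U| -> win E x v U.
Proof.
move=> iE cl xD Dm UK; have nx := unblocked_near x cl.
have [D1|D1] := leqP #|D| m; first exact: winsK iE nx D1 (ltnW UK).
have xU := inv_DU iE xD; apply: win_step => [|y yx]; first by lia.
have UK' r : r \in U -> K <= #|U :\ r| by move/card_rem->; lia.
have [yU|/negP yU] := boolP (y \in U); last first.
  have [d dD dx] := pick_dirty x D1; have dU := inv_DU iE dD.
  have dy : d <> y by congruence.
  have xyU : ~ (x \in U /\ y \in U) by case.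
  have [vd iE' cl'] := free_step iE nx yx xyU dU dx dy.
  suff /setUidPl eqD : newdirt x y U \subset D.
    exists d; split=> //; rewrite eqD in iE'.
    exact: win_small iE' (unblocked_near y cl') dD Dm (UK' _ dU).
  by apply/subsetP => u /newdirtP[uU [] [ux _]]; subst.
have [yD|yD] := boolP (y \in D).
  have [_ vy iE' nx'] := inner_step iE nx yx xU yU.
  by exists y; split=> //; apply: win_small iE' nx' yD Dm (UK' _ yU).
have [vx iE' ny] := inner_back iE (cl _ xU) yx xU yU.
by exists x; split=> //; apply: win_small iE' ny xD Dm (UK' _ xU).
Qed.

Let win_outside E x v U D : inv E v U D -> unblocked E v U -> x \notin U ->
  #|D| <= m.+1 -> K.+1 < #|U| -> win E x v U.
Proof.
move=> iE cl xU Dm UK; have nx := unblocked_near x cl.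
have [D1|D1] := leqP #|D| m; first by apply: winsK iE nx D1 _; lia.
apply: win_step => [|y yx]; first by lia.
have [d dD dy] := pick_dirty y D1; have dU := inv_DU iE dD.
have dx : d <> x by move=> ?; subst; rewrite dU in xU.
have xyU : ~ (x \in U /\ y \in U) by case=> xU'; rewrite xU' in xU.
have [vd iE' cl'] := free_step iE nx yx xyU dU dx dy.
have UK' : K < #|U :\ d| by rewrite card_rem //; lia.
exists d; split=> //.
have [yN|yN] := boolP (y \in newdirt x y U).
  apply: win_at_dirty iE' cl' _ _ UK'.
    by rewrite in_setD1 in_setU yN orbT andbT; apply/eqP; auto.
  rewrite card_rem ?inE ?dD //.
  have [Ule _] := leq_card_setU D (newdirt x y U).
  by have := card_newdirt x y (inv_frame iE); lia.
suff /setUidPl eqD : newdirt x y U \subset D.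
  by rewrite eqD in iE'; apply: win_small iE' (unblocked_near y cl') dD Dm (ltnW UK').
apply/subsetP => u uN; have [uU [] [ux _]] := newdirtP uN; subst.
  by rewrite uU in xU.
by rewrite uN in yN.
Qed.

Let win_at E v U D z : inv E v U D -> near E v v U z ->
  #|D| <= m.+1 -> K.+1 < #|U| -> win E v v U.
Proof.
move=> iE nz Dm UK.
have [D1|D1] := leqP #|D| m; first by apply: winsK iE nz D1 _; lia.
have fr := inv_frame iE; have /negP vU := frame_v fr.
apply: win_step => [|y yv]; first by lia.
have N0 : newdirt v y U = set0.
  apply/setP => u; rewrite in_set0; apply/negP => /newdirtP[uU []] [? ev].
    by subst.
  exact: frame_vs fr ev.
have xyU : ~ (v \in U /\ y \in U) by case.
have UK' r : r \in U -> K < #|U :\ r| by move/card_rem->; lia.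
have [/existsP[d /and3P[dD /eqP dz /eqP dy]]|] :=
    boolP [exists d, [&& d \in D, d != z & d != y]].
  have dU := inv_DU iE dD.
  have [vd iE' cl] := free_step iE nz yv xyU dU dz dy.
  rewrite N0 setU0 in iE'; exists d; split=> //.
  exact: win_small iE' (unblocked_near y cl) dD Dm (ltnW (UK' _ dU)).
rewrite negb_exists => /forallP noD.
have [|r [rU rz ry]] := @pick_neq2 U z y; first by lia.
have [vr iE' cl] := free_step iE nz yv xyU rU rz ry.
rewrite N0 setU0 in iE'; exists r; split=> //.
apply: win_at_dirty iE' cl _ _ (UK' _ rU); last first.
  exact: leq_trans (subset_leq_card (subD1set _ _)) Dm.
have [d dD dz] := pick_dirty z D1.
have := noD d; rewrite dD /= negb_and !negbK => /orP[] /eqP // dy; subst d.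
by rewrite !inE dD andbT; apply/eqP; auto.
Qed.

Lemma wins_uptoS : wins_upto m.+1 K.+3.
Proof.
move=> E x v U D z iE nz Dm UK.
have [D1|D1] := leqP #|D| m; first by apply: winsK iE nz D1 _; lia.
have fr := inv_frame iE; have /negP vU := frame_v fr.
apply: win_step => [|y yx]; first by lia.
have UK' r : r \in U -> K.+1 < #|U :\ r| by move/card_rem->; lia.
have [/andP[xU yU]|/andP xyU] := boolP ((x \in U) && (y \in U)).
  have [_ vy iE' nx] := inner_step iE nz yx xU yU.
  exists y; split=> //; apply: win_at iE' nx _ (UK' _ yU).
  exact: leq_trans (subset_leq_card (subD1set _ _)) Dm.
have Nle := card_newdirt x y fr; have [Ule _] := leq_card_setU D (newdirt x y U).
have [/existsP[d /and3P[dD /eqP dz /eqP dy]]|] :=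
    boolP [exists d, [&& d \in D, d != z & d != y]].
  have dU := inv_DU iE dD.
  have [vd iE' cl] := free_step iE nz yx xyU dU dz dy.
  have Dm' : #|(D :|: newdirt x y U) :\ d| <= m.+1 by rewrite card_rem ?inE ?dD //; lia.
  exists d; split=> //; have [yU|yU] := boolP (y \in U); last first.
    by apply: win_outside iE' cl _ Dm' (UK' _ dU); rewrite !inE (negPf yU) andbF.
  have [yN|yN] := boolP (y \in newdirt x y U).
    apply: win_at_dirty iE' cl _ Dm' (ltnW (UK' _ dU)).
    by rewrite in_setD1 in_setU yN orbT andbT; apply/eqP; auto.
  suff /setUidPl eqD : newdirt x y U \subset D.
    rewrite eqD in iE'; apply: win_small iE' (unblocked_near y cl) dD Dm _.
    by have := UK' _ dU; lia.
  apply/subsetP => u uN; have [uU [] [ux _]] := newdirtP uN; subst.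
    by case: xyU.
  by rewrite uN in yN.
rewrite negb_exists => /forallP noD.
have [|r [rU rz ry]] := @pick_neq2 U z y; first by lia.
have [vr iE' cl] := free_step iE nz yx xyU rU rz ry.
have yD : y \in D.
  have [d dD dz] := pick_dirty z D1.
  by have := noD d; rewrite dD /= negb_and !negbK => /orP[] /eqP // <-.
have yU := inv_DU iE yD.
exists r; split=> //; apply: win_at_dirty iE' cl _ _ (ltnW (UK' _ rU)).
  by rewrite in_setD1 in_setU yD andbT; apply/eqP; auto.
apply: leq_trans (subset_leq_card (subD1set _ _)) _.
suff /setUidPl-> : newdirt x y U \subset D by [].
apply/subsetP => u uN; have [uU [] [ux _]] := newdirtP uN; subst=> //.
by case: xyU.
Qed.

End Reduce.

Lemma wins_upto3 : wins_upto 3 11.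
Proof. by do 2!apply: wins_uptoS => //; apply: wins_upto1. Qed.

End Lollipop.

Section Plays.

Variable n : nat.
Implicit Types (w bs ms : moves n) (d : move n) (a b v x y : 'I_n).

Definition adj w a b : bool := [set a; b] \in claimed w.

Lemma set2_eq a b x y :
  ([set a; b] == [set x; y]) = ((a == x) && (b == y)) || ((a == y) && (b == x)).
Proof.
apply/eqP/idP => [eq|/orP[]/andP[/eqP-> /eqP->] //]; last by rewrite setUC.
have: a \in [set x; y] by rewrite -eq set21.
have: b \in [set x; y] by rewrite -eq set22.
have: x \in [set a; b] by rewrite eq set21.
have: y \in [set a; b] by rewrite eq set22.
rewrite !inE ![_ == a]eq_sym ![_ == b]eq_sym.
by do 2![case: (a == x); case: (a == y); case: (b == x); case: (b == y)].
Qed.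

Lemma adjC w a b : adj w a b = adj w b a.
Proof. by rewrite /adj setUC. Qed.

Lemma adj_nil a b : adj [::] a b = false.
Proof. by apply/negP => /imsetP[]. Qed.

Lemma adjP w a b :
  reflect (exists2 d, d \in w & (a = d.1 /\ b = d.2) \/ (a = d.2 /\ b = d.1)) (adj w a b).
Proof.
apply: (iffP imsetP) => [[d dw /eqP]|[d dw ab]].
  by rewrite set2_eq => /orP[]/andP[/eqP-> /eqP->]; exists d => //; [left|right].
exists d => //; apply/eqP; rewrite set2_eq.
by case: ab => -[-> ->]; rewrite !eqxx ?orbT.
Qed.

Lemma adj_rcons w d a b : adj (rcons w d) a b =
  adj w a b || ((a == d.1) && (b == d.2)) || ((a == d.2) && (b == d.1)).
Proof.
apply/adjP/idP => [[e]|].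
  rewrite mem_rcons inE => /orP[/eqP->|ew] ab.
    by case: ab => -[-> ->]; rewrite !eqxx ?orbT.
  by apply/orP; left; apply/orP; left; apply/adjP; exists e.
rewrite -orbA => /orP[/adjP[e ew ab]|ab].
  by exists e => //; rewrite mem_rcons inE ew orbT.
exists d; first by rewrite mem_rcons mem_head.
by case/orP: ab => /andP[/eqP-> /eqP->]; [left|right].
Qed.

Lemma position_rcons w d : position (rcons w d) = Some d.2.
Proof. by rewrite /position map_rcons rev_rcons. Qed.

Inductive walk : moves n -> Prop :=
| walk_nil : walk [::]
| walk_rcons w d : walk w -> (if position w is Some v then d.1 == v else true) ->
    d.1 != d.2 -> walk (rcons w d).

Definition valid bs ms : Prop :=
  [/\ walk bs, walk ms & forall a b, adj ms a b -> ~~ adj bs a b].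

Lemma legal_left bs ms d : valid bs ms -> legal bs ms d -> valid (rcons bs d) ms.
Proof.
move=> [wb wm dis] /and3P[pos loop free]; split=> //; first exact: walk_rcons.
move=> a b ab; rewrite adj_rcons (negPf (dis _ _ ab)) /=.
apply/negP => /orP[]/andP[/eqP ? /eqP ?]; subst; move: free ab.
  by rewrite /adj => /negPf->.
by rewrite adjC /adj => /negPf->.
Qed.

Lemma legal_right bs ms d : valid bs ms -> legal ms bs d -> valid bs (rcons ms d).
Proof.
move=> [wb wm dis] /and3P[pos loop free]; split=> //; first exact: walk_rcons.
move=> a b; rewrite adj_rcons -orbA => /orP[/dis //|].
case/orP=> /andP[/eqP-> /eqP->]; first exact: free.
by rewrite adjC.
Qed.

Definition ham w : Prop := contains_hamilton_cycle (claimed w).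

Lemma ham_rcons w d : ham w -> ham (rcons w d).
Proof.
move=> [c [c2 uc cv cc]]; exists c; split=> //.
apply: sub_cycle cc => u v uv; move: (adj_rcons w d u v).
by rewrite /adj uv => ->.
Qed.

Fixpoint wins t bs ms : Prop :=
  ham ms \/
  if t is t'.+1 then forall d, legal bs ms d ->
    exists2 e, legal ms (rcons bs d) e & wins t' (rcons bs d) (rcons ms e)
  else False.

Lemma wins_ham t bs ms : ham ms -> wins t bs ms.
Proof. by case: t; left. Qed.

Lemma wins_mono t u bs ms : t <= u -> wins t bs ms -> wins u bs ms.
Proof.
elim: t u bs ms => [|t IH] u bs ms; first by move=> _ [/wins_ham|[]].
case: u => // u tu [/wins_ham//|step]; right=> d ld.
by have [e le wt] := step d ld; exists e => //; apply: IH wt.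
Qed.

Lemma legal_ex bs ms : 2 < n -> valid bs ms -> size bs = (size ms).+1 ->
  exists d, legal ms bs d.
Proof.
move=> n2 [wb wm dis]; case/lastP: ms wm dis => [_ _|ms d wm dis _].
  case: bs wb => [|b [|]] // _ _.
  have [c cb] : exists c, c \notin [set b.1; b.2].
    apply/existsP; rewrite -negb_forall; apply/negP => /forallP all_b.
    have : #|[set b.1; b.2]| = n.
      by rewrite -[RHS]card_ord -cardsT; congr #|pred_of_set _|; apply/setP => i; rewrite all_b inE.
    by rewrite cards2; case: (_ != _); lia.
  move: cb; rewrite !inE negb_or => /andP[c1 c2].
  exists (c, b.1); rewrite /legal /= c1 /=; apply/imsetP => -[e].
  rewrite inE => /eqP-> /eqP; rewrite set2_eq (negPf c1) (negPf c2).
  by [].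
have [ld dw] : d.1 != d.2 /\ d \in rcons ms d.
  split; last by rewrite mem_rcons mem_head.
  inversion wm as [|w' d' _ _ loop eq]; first by case: (ms) H => //.
  by have [_ <-] := rcons_inj eq.
exists (d.2, d.1); rewrite /legal position_rcons eqxx /= eq_sym ld /=.
by apply: dis; apply/adjP; exists d; auto.
Qed.

Lemma strategy_of_wins T : 2 < n -> wins T [::] [::] ->
  exists S : strategy n, legal_strategy S /\ wins_within S T.
Proof.
move=> n2 winT.
have inh : inhabited (move n) by have o := Ordinal (ltn_trans (ltnSn 1) n2); exists; split.
pose good bs ms e := wins (T - (size ms).+1) bs (rcons ms e).
pose best bs ms e := legal ms bs e /\
  ((exists2 e', legal ms bs e' & good bs ms e') -> good bs ms e).
pose S bs ms : move n := epsilon inh (best bs ms).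
have S_spec bs ms : valid bs ms -> size bs = (size ms).+1 ->
    best bs ms (S bs ms).
  move=> vd sz; apply: (epsilon_spec inh (best bs ms)).
  have [[e' le' ge']|no] := excluded_middle_informative
    (exists2 e', legal ms bs e' & good bs ms e'); first by exists e'.
  by have [e le] := legal_ex n2 vd sz; exists e.
have cons bs ms : consistent S bs ms -> valid bs ms /\ size bs = size ms.
  elim=> [|{}bs {}ms b _ [vd sz] lb].
    by split=> //; split; try constructor; move=> a b; rewrite adj_nil.
  have vd' := legal_left vd lb; have sz' : size (rcons bs b) = (size ms).+1.
    by rewrite size_rcons sz.
  have [lS _] := S_spec _ _ vd' sz'.
  by split; [apply: legal_right vd' lS|rewrite !size_rcons sz].
exists S; split=> [bs ms b /cons[vd sz] lb|].
  by apply: (S_spec _ _ (legal_left vd lb) _).1; rewrite size_rcons sz.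
have winS bs ms : consistent S bs ms -> size ms <= T -> wins (T - size ms) bs ms.
  elim=> [|{}bs {}ms b cbm IH lb]; first by rewrite subn0.
  rewrite size_rcons => sT; have {}IH := IH (ltnW sT).
  have [vd sz] := cons _ _ cbm.
  have [_ gS] := S_spec _ _ (legal_left vd lb) (etrans (size_rcons _ _) (congr1 _ sz)).
  move: IH; rewrite -(subnSK sT) /= => -[hm|/(_ b lb)[e le we]].
    exact/wins_ham/ham_rcons.
  by apply: gS; exists e.
move=> bs ms cbm sT; exists T => //.
have := winS _ _ cbm; rewrite sT subnn => /(_ (leqnn T))[] //.
by rewrite -sT take_size.
Qed.

End Plays.

Section Cycles.

Variables (T : eqType) (e : rel T).
Hypothesis e_sym : symmetric e.

Lemma cycle_rev c : cycle e (rev c) = cycle e c.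
Proof. by rewrite rev_cycle; apply: eq_cycle => u v. Qed.

Lemma cycle_insert c q f w : uniq c -> cycle e c -> q \in c -> f \in c ->
  w \notin c -> f != q -> f != next c q -> f != prev c q ->
  e q w -> e w f -> e (next c f) (next c q) ->
  exists c', [/\ uniq c', c' =i w :: c & cycle e c'].
Proof.
move=> uc cc qc; have [i A def_c] := rot_to qc.
have uA : uniq (q :: A) by rewrite -def_c rot_uniq.
have cA : cycle e (q :: A) by rewrite -def_c rot_cycle.
have mem_c : c =i q :: A by move=> a; rewrite -def_c mem_rot.
rewrite -(next_rot i uc) -(prev_rot i uc) -(next_rot i uc) def_c !mem_c.
move=> fA wA fq; have {}fA : f \in A by move: fA; rewrite inE (negPf fq).
case/splitPr: fA uA cA mem_c wA {def_c} => A1 A2 uA cA mem_c wA.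
have qA : q \notin A1 ++ f :: A2 by case/andP: uA.
have fA1 : f \notin A1.
  by move: uA; rewrite /= cat_uniq /= => /and4P[_ _ /norP[]].
rewrite !next_nth !prev_nth /= !inE !mem_cat !inE !eqxx (eq_sym q f) (negPf fq) /= !orbT.
rewrite memNindex // index_cat (negPf fA1) /= eqxx addn0 size_cat /=.
case: A1 => [|h A1] in uA cA mem_c wA qA fA1 *; first by rewrite eqxx.
case: A2 => [|g A2] in uA cA mem_c wA qA *.
  have eqf : nth q ((h :: A1) ++ [:: f]) (size (h :: A1)) = f.
    by rewrite nth_cat ltnn subnn.
  by rewrite addn1 [nth _ (q :: _) _]eqf eqxx.
have eqg : nth q ((h :: A1) ++ [:: f, g & A2]) (size (h :: A1)).+1 = g.
  by rewrite nth_cat ltnNge leqnSn subSnn.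
rewrite eqg => _ _ eqw ewf; rewrite -[nth _ _ 0]/h => egh.
pose c' := q :: w :: f :: rev (h :: A1) ++ g :: A2.
have perm_c' : perm_eq c' (w :: q :: (h :: A1) ++ [:: f, g & A2]).
  rewrite /c'; clear; apply/permP => a; rewrite /= !count_cat /= count_rev /=.
  by do 5!move: (nat_of_bool _) => ?; lia.
exists c'; split.
- by rewrite (perm_uniq perm_c') cons_uniq wA.
- by move=> a; rewrite (perm_mem perm_c') !inE mem_c !inE.
have revA : path e f (rev (h :: A1)) = path e h (rcons A1 f).
  rewrite -{1}(last_rcons h A1 f) -(belast_rcons h A1 f) rev_path.
  by apply: eq_path => u v; rewrite e_sym.
move: cA; rewrite /= !rcons_cat /= !cat_path /= eqw ewf revA !rcons_path.
rewrite rev_cons last_rcons /= (e_sym h g) egh.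
by case/and5P => _ -> -> _ /andP[-> ->].
Qed.

End Cycles.

Section Counting.

Variable n : nat.
Implicit Types (w bs ms : moves n) (d : move n) (a b v x y : 'I_n).

Lemma card_seq_le (A : {set 'I_n}) (s : seq 'I_n) : {subset A <= s} -> #|A| <= size s.
Proof. by move=> /subsetP/subset_leq_card/leq_trans-> //; apply: card_size. Qed.

Definition visits w a : nat := count (fun d => d.1 == a) w + count (fun d => d.2 == a) w.

Lemma card_adj w a : #|[set b | adj w a b]| <= visits w a.
Proof.
pose s := [seq d.2 | d <- w & d.1 == a] ++ [seq d.1 | d <- w & d.2 == a].
have -> : visits w a = size s by rewrite size_cat !size_map !size_filter.
apply: card_seq_le => b; rewrite inE mem_cat => /adjP[d dw [[-> ->]|[-> ->]]].
  by apply/orP; left; apply: map_f; rewrite mem_filter eqxx.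
by apply/orP; right; apply: map_f; rewrite mem_filter eqxx.
Qed.

Lemma visits_rcons w d a : visits (rcons w d) a <= visits w a + 2.
Proof. by rewrite /visits -!cats1 !count_cat /=; do 2!case: (_ == _); lia. Qed.

Lemma sum_visits w : \sum_a visits w a = 2 * size w.
Proof.
have sum1 (f : move n -> 'I_n) : \sum_a count (fun d => f d == a) w = size w.
  elim: w => [|d w IH] /=; first by rewrite big1.
  rewrite big_split /= IH (bigD1 (f d)) //= eqxx big1 // => a.
  by rewrite eq_sym => /negPf->.
by rewrite /visits big_split /= !sum1 mul2n addnn.
Qed.

Lemma card_visits w k : #|[set a | k < visits w a]| * k.+1 <= 2 * size w.
Proof.
rewrite -sum_visits -sum_nat_const big_mkcond /= leq_sum // => a _.
by rewrite inE; case: ltnP.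
Qed.

Lemma walk_in a0 w : walk w -> exists x, forall d, d \in w ->
  d.1 = x \/ exists2 e, e \in w & d.1 = e.2.
Proof.
elim=> [|{}w d wk [x IH] pos _]; first by exists a0.
case/lastP: w => [|w c] in wk IH pos *.
  by exists d.1 => e; rewrite inE => /eqP->; left.
rewrite position_rcons in pos; exists x => e.
rewrite mem_rcons inE => /orP[/eqP->|/IH[->|[f fw ->]]].
- by right; exists c; [rewrite !(mem_rcons, inE) eqxx orbT|apply/eqP].
- by left.
- by right; exists f; rewrite // mem_rcons inE fw orbT.
Qed.

Lemma walk_out a0 w : walk w -> exists x, forall d, d \in w ->
  d.2 = x \/ exists2 e, e \in w & d.2 = e.1.
Proof.
suff out : walk w -> forall x, position w = Some x -> forall d, d \in w ->
    d.2 = x \/ exists2 e, e \in w & d.2 = e.1.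
  case/lastP: w out => [|w c] out wk; first by exists a0.
  by exists c.2; apply: out wk _ (position_rcons _ _).
elim=> // {}w d wk IH pos _ x; rewrite position_rcons => -[<-] e.
rewrite mem_rcons inE => /orP[/eqP->|ew]; first by left.
right; case def_w : (position w) pos => [v|] pos; last first.
  by case/lastP: w def_w ew {wk IH} => // w c; rewrite position_rcons.
case: (IH _ def_w _ ew) => [->|[f fw ->]].
  by exists d; [rewrite mem_rcons mem_head|apply/esym/eqP].
by exists f; rewrite // mem_rcons inE fw orbT.
Qed.

(* Each vertex of the boundary is reached from X or left towards X.  Bounding the *)
(* boundary by the moves leaving X plus those entering X, by the moves not        *)
(* starting in X, and by the moves not ending in X gives three bounds whose sum   *)
(* is 2t + 2 for a walk of t moves.                                               *)
Lemma card_boundary w (X : {set 'I_n}) : walk w ->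
  3 * #|[set u | (u \notin X) && [exists a in X, adj w a u]]| <= 2 * size w + 2.
Proof.
move=> wk; set N := [set u | _].
have [->|[a0 _]] := set_0Vmem N; first by rewrite cards0.
have inN u : u \in N -> u \notin X /\ exists2 d, d \in w &
    (u = d.2 /\ d.1 \in X) \/ (u = d.1 /\ d.2 \in X).
  rewrite inE => /andP[uX /existsP[a /andP[aX /adjP[d dw ab]]]]; split=> //.
  by exists d => //; case: ab => -[<- <-]; [left|right].
have [x xw] := walk_in a0 wk; have [y yw] := walk_out a0 wk.
pose p1 d := d.1 \in X; pose p2 d := d.2 \in X.
have N12 : #|N| <= count p1 w + count p2 w.
  pose s := [seq d.2 | d <- w & p1 d] ++ [seq d.1 | d <- w & p2 d].
  have -> : count p1 w + count p2 w = size s by rewrite size_cat !size_map !size_filter.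
  apply: card_seq_le => u /inN[_ [d dw ud]]; rewrite mem_cat.
  case: ud => -[-> dX]; apply/orP; [left|right]; apply: map_f;
    by rewrite mem_filter dw andbT.
have N1 : #|N| <= (count (predC p1) w).+1.
  rewrite -size_filter -(size_map (fun d => d.1)).
  apply: (@card_seq_le _ (y :: _)) => u /inN[uX [d dw [[du dX]|[du dX]]]]; rewrite inE; last first.
    by rewrite du map_f ?orbT // mem_filter /= /p1 -du uX.
  case: (yw _ dw) => [<-|[f fw df]]; first by rewrite du eqxx.
  by rewrite du df map_f ?orbT // mem_filter /= /p1 -df -du uX.
have N2 : #|N| <= (count (predC p2) w).+1.
  rewrite -size_filter -(size_map (fun d => d.2)).
  apply: (@card_seq_le _ (x :: _)) => u /inN[uX [d dw [[du dX]|[du dX]]]]; rewrite inE.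
    by rewrite du map_f ?orbT // mem_filter /= /p2 -du uX.
  case: (xw _ dw) => [<-|[f fw df]]; first by rewrite du eqxx.
  by rewrite du df map_f ?orbT // mem_filter /= /p2 -df -du uX.
by have := count_predC p1 w; have := count_predC p2 w; lia.
Qed.

End Counting.

Section Insertion.

Variable n : nat.
Implicit Types (bs ms : moves n) (d : move n) (a b v x y : 'I_n).

Definition stands bs ms x v : Prop :=
  [/\ valid bs ms, position bs = Some x, position ms = Some v & size bs = size ms].

Lemma adj_add bs x y a b : adj (rcons bs (x, y)) a b -> add_edge (adj bs) x y a b.
Proof.
rewrite adj_rcons /add_edge => /orP[/orP[|/andP[/eqP-> /eqP->]]|/andP[/eqP-> /eqP->]]; auto.
Qed.

Lemma wins_step t bs ms x v : stands bs ms x v ->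
  (forall y, y <> x -> ~~ adj ms x y ->
    exists r, [/\ r <> v, ~ adj (rcons bs (x, y)) v r
      & stands (rcons bs (x, y)) (rcons ms (v, r)) y r ->
        wins t (rcons bs (x, y)) (rcons ms (v, r))]) ->
  wins t.+1 bs ms.
Proof.
move=> [vd px pv sz] step; right=> -[x' y] lg.
have /and3P[] := lg; rewrite px /= => /eqP ? /eqP xy free; subst x'.
have [|r [rv /negP vr wt]] := step y _ free; first by move=> ?; subst.
have vd' := legal_left vd lg.
have lm : legal ms (rcons bs (x, y)) (v, r).
  by rewrite /legal pv /= eqxx vr andbT; apply/eqP => ?; subst.
exists (v, r) => //; apply: wt; split; try by rewrite position_rcons.
  exact: legal_right.
by rewrite !size_rcons sz.
Qed.

Lemma own_free bs ms x y v a b : stands bs ms x v -> ~~ adj ms x y ->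
  adj ms a b -> ~ adj (rcons bs (x, y)) a b.
Proof.
move=> [[_ _ dis] _ _ _] xy ab; rewrite adj_rcons (negPf (dis _ _ ab)) /=.
by case/orP => /andP[/eqP ? /eqP ?]; subst; [|rewrite adjC in ab]; rewrite ab in xy.
Qed.

Definition covers (c : seq 'I_n) (w : 'I_n) : Prop := forall a, (a \in c) = (a != w).

Lemma ham_insert c q f w ms : 2 < n -> uniq c -> cycle (adj ms) c -> covers c w ->
  q != w -> f != w -> f != q -> f != next c q -> f != prev c q ->
  adj ms q w -> adj ms w f -> adj ms (next c f) (next c q) -> ham ms.
Proof.
move=> n2 uc cc cw qw fw fq fn fp eqw ewf egh.
have [|||c' [uc' mc' cc']] := cycle_insert (adjC ms) uc cc _ _ _ fq fn fp eqw ewf egh.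
- by rewrite cw.
- by rewrite cw.
- by rewrite cw eqxx.
have all_c' a : a \in c' by rewrite mc' inE cw; case: eqP.
exists c'; split=> //; rewrite -(card_uniqP uc').
by rewrite (eq_card (B := predT)) ?card_ord.
Qed.

Lemma wins_at_f bs ms x c q f w : 2 < n -> stands bs ms x f ->
  uniq c -> cycle (adj ms) c -> covers c w ->
  q != w -> f != w -> f != q -> f != next c q -> f != prev c q ->
  next c f != prev c q -> prev c f != next c q ->
  next c f != prev c f -> next c q != prev c q ->
  adj ms q w -> adj ms w f ->
  ~~ adj bs (next c f) (next c q) -> ~~ adj bs (prev c f) (prev c q) ->
  wins 2 bs ms.
Proof.
move=> n2 st uc cc cw qw fw fq fn fp nfpq pfnq nfpf nqpq eqw ewf en ep.
have fc : f \in c by rewrite cw.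
have qc : q \in c by rewrite cw.
have adj_n a : a \in c -> adj ms a (next c a) by move=> ac; apply: next_cycle.
have adj_p a : a \in c -> adj ms a (prev c a) by move=> ac; rewrite adjC; apply: prev_cycle.
have finish y g h bs' : stands bs' (rcons ms (f, g)) y g -> y <> g -> y <> h -> h <> g ->
    ~~ adj bs' g h -> (forall ms', {subset ms <= ms'} -> adj ms' g h -> ham ms') ->
    wins 1 bs' (rcons ms (f, g)).
  move=> st' yg yh hg gh hm; apply: wins_step st' _ => z zy _.
  exists h; split=> //.
    by rewrite adj_rcons (negPf gh) /= => /orP[] /andP[/eqP ? /eqP ?]; subst.
  move=> _; apply/wins_ham/hm; last by rewrite adj_rcons !eqxx !orbT.
  by move=> d dm; rewrite !(mem_rcons, inE) dm !orbT.
have sub_adj ms' : {subset ms <= ms'} -> subrel (adj ms) (adj ms').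
  by move=> sub a b /adjP[d /sub dm ab]; apply/adjP; exists d.
apply: (wins_step st) => y yx xy.
have free_n := own_free st xy (adj_n _ fc).
have free_p := own_free st xy (adj_p _ fc).
have neq_adj g h : adj ms g h -> h <> g.
  move=> gh ?; subst h; case: st => -[_ wm _] _ _ _; move: gh.
  elim: wm => [|ms' d _ IH _ loop]; first by rewrite adj_nil.
  rewrite adj_rcons => /orP[/orP[/IH //|]|] /andP[/eqP-> /eqP eq];
    by rewrite eq eqxx in loop.
have up_cyc ms' : {subset ms <= ms'} -> cycle (adj ms') c.
  by move=> /sub_adj/sub_cycle; apply.
have no_new g h : ~~ adj bs g h -> y != g -> y != h -> ~~ adj (rcons bs (x, y)) g h.
  move=> /negPf gh /negPf yg /negPf yh; rewrite adj_rcons gh /=.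
  by rewrite ![_ == y]eq_sym yg yh andbF.
have [/norP[yf yq]|ynn] := boolP (~~ ((y == next c f) || (y == next c q))).
  exists (next c f); split=> //; first exact/neq_adj/adj_n.
  move=> st'; apply: finish st' _ _ _ (no_new _ _ en yf yq) _; try exact/eqP.
    by move/(congr1 (prev c)); rewrite !prev_next // => /esym/eqP; apply/negP.
  move=> ms' sub egh; have sa := sub_adj _ sub.
  by apply: (@ham_insert c q f w) => //; [apply: up_cyc|apply: sa..].
have [ypf ypq] : y != prev c f /\ y != prev c q.
  by move: ynn; rewrite negbK => /orP[] /eqP->; rewrite 1?(eq_sym (next c q) (prev c f)).
exists (prev c f); split=> //; first by apply: neq_adj; apply: adj_p.
move=> st'; apply: finish st' _ _ _ (no_new _ _ ep ypf ypq) _; try exact/eqP.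
  by move/(congr1 (next c)); rewrite !next_prev // => /esym/eqP; apply/negP.
move=> ms' sub egh; have sa := sub_adj _ sub.
apply: (@ham_insert (rev c) q f w); rewrite ?rev_uniq ?next_rev ?prev_rev //.
- by rewrite (cycle_rev (adjC _)); apply: up_cyc.
- by move=> a; rewrite mem_rev cw.
- exact: sa.
- exact: sa.
Qed.

Lemma next_neq_prev (c : seq 'I_n) a : uniq c -> 2 < size c -> a \in c ->
  next c a != prev c a.
Proof.
move=> uc sc ac; have [i s def_c] := rot_to ac.
rewrite -(next_rot i uc) -(prev_rot i uc); move: uc sc.
rewrite -(rot_uniq i) -(size_rot i) def_c.
case: s {def_c} => [|b [|d s]] // uc _; rewrite next_nth prev_nth !mem_head /= eqxx.
case/and3P: uc => aN bN _; move: aN; rewrite !inE !negb_or => /and3P[ab ad sa].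
rewrite !(eq_sym _ a) (negPf ab) (negPf ad) memNindex //.
have -> : nth a [:: a, b, d & s] (size s).+2 = last d s by apply: (nth_last a (d :: s)).
by apply: contra bN => /eqP /= ->; apply: mem_last.
Qed.

Lemma cycle_rcons (c : seq 'I_n) ms d : cycle (adj ms) c -> cycle (adj (rcons ms d)) c.
Proof. by apply: sub_cycle => a b; rewrite adj_rcons => ->. Qed.

Lemma covers_size (c : seq 'I_n) w : uniq c -> covers c w -> size c = n.-1.
Proof.
move=> uc cw; rewrite -(card_uniqP uc) -[n in RHS]card_ord -cardsT (cardsD1 w) inE /=.
by apply: eq_card => a; rewrite cw !inE andbT.
Qed.

Lemma pick_ord (B : {set 'I_n}) : #|B| < n -> exists a, a \notin B.
Proof.
by rewrite -[n in _ < n]card_ord -cardsT => /pick_notin[a _ aB]; exists a.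
Qed.

Lemma wins_at_w bs ms x c q w : 400 <= n -> size bs <= n + 4 -> stands bs ms x w ->
  uniq c -> cycle (adj ms) c -> covers c w -> q != w -> adj ms q w ->
  visits bs (next c q) <= 25 -> visits bs (prev c q) <= 25 -> wins 3 bs ms.
Proof.
move=> n_big sb st uc cc cw qw eqw vn vp.
have sc := covers_size uc cw; have c3 : 2 < size c by rewrite sc; lia.
have qc : q \in c by rewrite cw.
apply: (wins_step st) => y yx xy; set bs' := rcons bs (x, y).
have wb' : walk bs'.
  have [[wb _ _] px _ _] := st; apply: walk_rcons => //=; last exact/eqP/nesym.
  by rewrite px.
pose Nw := [set u | (u \notin [set w]) && [exists a in [set w], adj bs' a u]].
pose Nn := [set b | adj bs' (next c q) b]; pose Np := [set b | adj bs' (prev c q) b].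
pose F := [set w; q; next c q; prev c q; next c (next c q); prev c (prev c q)].
have cF : #|F| <= 6.
  apply: (@card_seq_le _ _ [:: w; q; next c q; prev c q; next c (next c q);
    prev c (prev c q)]) => a.
  by rewrite !inE -!orbA.
have cNw : 3 * #|Nw| <= _ := card_boundary [set w] wb'.
have cNn : #|prev c @: Nn| <= 27.
  apply: leq_trans (leq_imset_card _ _) (leq_trans (card_adj _ _) _).
  by apply: leq_trans (visits_rcons _ _ _) _; lia.
have cNp : #|next c @: Np| <= 27.
  apply: leq_trans (leq_imset_card _ _) (leq_trans (card_adj _ _) _).
  by apply: leq_trans (visits_rcons _ _ _) _; lia.
have [|f] := @pick_ord (F :|: Nw :|: prev c @: Nn :|: next c @: Np).
  have sb' : size bs' <= n + 5 by rewrite size_rcons; lia.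
  have [U1 _] := leq_card_setU (F :|: Nw :|: prev c @: Nn) (next c @: Np).
  have [U2 _] := leq_card_setU (F :|: Nw) (prev c @: Nn).
  have [U3 _] := leq_card_setU F Nw.
  by apply: leq_ltn_trans U1 _; lia.
rewrite !in_setU !negb_or => /andP[/andP[/andP[fF fNw] fNn] fNp].
move: fF; rewrite !inE -!andbA => /and5P[fw fq fn fp /andP[fnn fpp]].
have fc : f \in c by rewrite cw.
have free_f : ~ adj bs' w f.
  move=> wf; case/negP: fNw; rewrite inE in_set1 fw /=; apply/existsP.
  by exists w; rewrite set11.
exists f; split=> // [|st']; first exact/eqP.
apply: (@wins_at_f _ _ _ c q f w _ st') => //; try exact: cycle_rcons.
- exact: leq_trans n_big.
- by apply: contra fpp => /eqP <-; rewrite prev_next.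
- by apply: contra fnn => /eqP <-; rewrite next_prev.
- exact: next_neq_prev.
- exact: next_neq_prev.
- by rewrite adj_rcons eqw.
- by rewrite adj_rcons !eqxx orbT.
- apply: contra fNn => nn; apply/imsetP; exists (next c f); last by rewrite prev_next.
  by rewrite inE adjC.
- apply: contra fNp => pp; apply/imsetP; exists (prev c f); last by rewrite next_prev.
  by rewrite inE adjC.
Qed.

Lemma wins_at_q bs ms x c q w : 400 <= n -> size bs <= n + 3 -> stands bs ms x q ->
  uniq c -> cycle (adj ms) c -> covers c w -> q != w -> x != w -> x != q ->
  ~~ adj bs q w -> visits bs (next c q) <= 23 -> visits bs (prev c q) <= 23 ->
  wins 4 bs ms.
Proof.
move=> n_big sb st uc cc cw qw /eqP xw /eqP xq free vn vp.
apply: (wins_step st) => y yx xy.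
exists w; split; first exact/nesym/eqP.
  by rewrite adj_rcons (negPf free) => /orP[]/andP[/eqP ? /eqP ?]; subst.
move=> st'; apply: (@wins_at_w _ _ _ c q w n_big _ st') => //.
- by rewrite size_rcons; lia.
- exact: cycle_rcons.
- by rewrite adj_rcons !eqxx orbT.
- by apply: leq_trans (visits_rcons _ _ _) _; lia.
- by apply: leq_trans (visits_rcons _ _ _) _; lia.
Qed.

Lemma jump_ex bs c p y w : 400 <= n -> size bs <= n + 2 -> walk bs -> uniq c -> p != w ->
  exists q, [/\ q != w, q != p, q != y, ~~ adj bs p q /\ ~~ adj bs q w
    & visits bs (next c q) <= 23 /\ visits bs (prev c q) <= 23].
Proof.
move=> n_big sb wb uc pw.
pose X := [set w; p].
pose N := [set u | (u \notin X) && [exists a in X, adj bs a u]].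
pose H := [set a | 23 < visits bs a].
have cN : 3 * #|N| <= _ := card_boundary X wb.
have cH : #|H| * 24 <= _ := card_visits bs 23.
have [Hp Hn] := (leq_imset_card (prev c) H, leq_imset_card (next c) H).
have cX : #|y |: X| <= 3 by rewrite cardsU1 cards2; case: (_ \notin _); case: (_ != _).
have [|q] := @pick_ord ((y |: X) :|: N :|: prev c @: H :|: next c @: H).
  have [U1 _] := leq_card_setU ((y |: X) :|: N :|: prev c @: H) (next c @: H).
  have [U2 _] := leq_card_setU ((y |: X) :|: N) (prev c @: H).
  have [U3 _] := leq_card_setU (y |: X) N.
  by apply: leq_ltn_trans U1 _; lia.
rewrite !in_setU !negb_or => /andP[/andP[/andP[qX qN] qHp] qHn].
move: qX; rewrite !inE => /and3P[qy qw qp].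
have free a : a \in X -> ~~ adj bs a q.
  move=> aX; apply: contra qN => aq; rewrite !inE !negb_or qw qp /=.
  by apply/existsP; exists a; rewrite aX.
exists q; split=> //; split.
- by apply: free; rewrite !inE eqxx orbT.
- by rewrite adjC; apply: free; rewrite !inE eqxx.
- rewrite leqNgt; apply: contra qHp => high; apply/imsetP.
  by exists (next c q); rewrite ?inE ?prev_next.
- rewrite leqNgt; apply: contra qHn => high; apply/imsetP.
  by exists (prev c q); rewrite ?inE ?next_prev.
Qed.

Lemma wins_on_cycle bs ms x p c w : 400 <= n -> size bs <= n -> stands bs ms x p ->
  uniq c -> cycle (adj ms) c -> covers c w -> p != w -> wins 6 bs ms.
Proof.
move=> n_big sb st uc cc cw pw; have pc : p \in c by rewrite cw.
have jump bs' ms' x' p' y : size bs' <= n.+1 -> stands bs' ms' x' p' ->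
    cycle (adj ms') c -> p' != w -> y <> x' -> y != w ->
    exists r, [/\ r <> p', ~ adj (rcons bs' (x', y)) p' r
      & stands (rcons bs' (x', y)) (rcons ms' (p', r)) y r ->
        wins 4 (rcons bs' (x', y)) (rcons ms' (p', r))].
  move=> sb' st' cc' pw' yx' yw.
  have wb : walk (rcons bs' (x', y)).
    have [[wb _ _] px _ _] := st'; apply: walk_rcons => //=; last exact/eqP/nesym.
    by rewrite px.
  have [|q [qw qp qy [fp fw] [vn vp]]] := @jump_ex _ c p' y w n_big _ wb uc pw'.
    by rewrite size_rcons; lia.
  exists q; split; [exact/eqP|exact/negP|move=> st''].
  apply: (@wins_at_q _ _ _ c q w n_big _ st'') => //; last by rewrite eq_sym.
    by rewrite size_rcons; lia.
  exact: cycle_rcons.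
apply: (wins_step st) => y yx xy.
have [yw|yw] := eqVneq y w; last first.
  have [r [rp pr wr]] := jump _ _ _ _ _ (leq_trans sb (leqnSn n)) st cc pw yx yw.
  by exists r; split=> // /wr; apply: wins_mono.
have epn : adj ms p (next c p) by apply: next_cycle.
have np : next c p <> p.
  have c3 : 2 < size c by rewrite (covers_size uc cw); lia.
  move=> np; have pp : prev c p = p by rewrite -{1}np prev_next.
  by have := next_neq_prev uc c3 pc; rewrite np pp eqxx.
exists (next c p); split=> //; first exact: own_free st xy epn.
move=> st'; apply: (wins_step st') => z zy _; apply: jump => //.
- by rewrite size_rcons.
- exact: cycle_rcons.
- by rewrite -cw mem_next.
- by apply/eqP; rewrite -yw.
Qed.

End Insertion.

Section Opening.

Variable n : nat.
Implicit Types (bs ms : moves n) (d : move n) (a b c v x y z : 'I_n) (U : {set 'I_n}).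

Definition spine ms U v s : Prop := exists p, [/\ uniq (v :: p), path (adj ms) v p,
  last v p = s & forall a, (a \in v :: p) = (a \notin U)].

Lemma spine_last ms U v s : spine ms U v s -> s \notin U.
Proof. by move=> [p [_ _ <- <-]]; apply: mem_last. Qed.

Lemma spine_head ms U v s : spine ms U v s -> v \notin U.
Proof. by move=> [p [_ _ _ <-]]; apply: mem_head. Qed.

Lemma spine_rcons ms U v s r : spine ms U v s -> r \in U ->
  spine (rcons ms (v, r)) (U :\ r) r s.
Proof.
move=> [p [up pp lp mp]] rU; exists (v :: p); split=> //.
- by rewrite cons_uniq mp rU.
- rewrite /= adj_rcons !eqxx !orbT /=; apply: sub_path pp => a b.
  by rewrite adj_rcons => ->.
- by move=> a; rewrite in_cons mp in_setD1 negb_and negbK.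
Qed.

Lemma wins_of_force k E bs ms x v U s1 s2 : 400 <= n -> stands bs ms x v ->
  (forall a b, adj bs a b -> E a b) -> #|U| = k.+1 -> size ms + #|U| = n ->
  s1 <> s2 -> v <> s1 -> v <> s2 -> spine ms U v s1 -> spine ms U v s2 ->
  force s1 s2 k E x v U -> wins (k.+1 + 6) bs ms.
Proof.
move=> n_big; elim: k E bs ms x v U => [|k IH] E bs ms x v U st sub cU sz s12 v1 v2 sp1 sp2.
  move=> cl; apply: (wins_step st) => y yx xy.
  have [w def_U] : exists w, U = [set w] by apply/cards1P; rewrite cU.
  have [s [es free]] : exists s, is_end s1 s2 s /\ ~ adj (rcons bs (x, y)) v s.
    case: cl => [[f1 f2]|[s [es fs xv xs]]]; last first.
      by exists s; split=> // /adj_add[/sub//|]; intuition congruence.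
    have [/adj_add e1|/negP e1] := boolP (adj (rcons bs (x, y)) v s1); last first.
      by exists s1; split=> //; left.
    exists s2; split; first by right.
    move=> /adj_add e2; case: e1 => [/sub//|]; case: e2 => [/sub//|].
    by intuition congruence.
  have vs : v <> s by case: es => ->.
  have [p [up pp lp mp]] : spine ms U v s by case: es => ->.
  exists s; split=> //; first exact: nesym.
  move=> st'; apply: (@wins_on_cycle _ _ _ _ s (v :: p) w n_big _ st') => //.
  - by case: st => _ _ _; rewrite size_rcons => ->; lia.
  - rewrite /= rcons_path lp adj_rcons !eqxx !orbT andbT.
    by apply: sub_path pp => a b; rewrite adj_rcons => ->.
  - by move=> a; rewrite mp def_U inE.
  - by rewrite -in_set1 -def_U -mp -lp mem_last.
move=> fc; apply: (wins_step st) => y yx xy; have [r [rU vr fr]] := fc y yx.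
have neqU a : a \notin U -> r <> a by move=> aU ra; rewrite -ra rU in aU.
exists r; split.
- exact/neqU/(spine_head sp1).
- by move=> /adj_add[/sub e|e]; apply: vr; [left|right].
move=> st'; apply: IH fr => //.
- by move=> a b /adj_add[/sub|]; [left|right].
- by rewrite card_rem ?cU.
- by rewrite size_rcons card_rem // cU /=; lia.
- exact/neqU/(spine_last sp1).
- exact/neqU/(spine_last sp2).
- exact: spine_rcons.
- exact: spine_rcons.
Qed.

Lemma wins_lollipop bs ms x c q s1 s2 (D : seq 'I_n) z : 400 <= n -> size q < 20 ->
  stands bs ms x c -> size ms = (size q).+1 -> uniq (c :: q) -> cycle (adj ms) (c :: q) ->
  s1 = head c q -> s2 = last c q -> s1 <> s2 -> c <> s1 -> c <> s2 ->
  (forall a b, a \notin c :: q -> b \notin c :: q -> ~ adj bs a b) ->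
  (forall a, a \notin c :: q -> adj bs a s1 || adj bs a s2 -> a \in D) -> size D <= 3 ->
  (forall a, a \notin c :: q -> adj bs c a -> a = z) -> x = c \/ x = z ->
  wins (n + 6 - size ms) bs ms.
Proof.
move=> n_big q20 st sz uq cq def1 def2 s12 c1 c2 UU dirt D3 Nz xz.
pose U := [set a | a \notin c :: q].
have cU : size ms + #|U| = n.
  rewrite sz -/(size (c :: q)) -(card_uniqP uq) -[RHS]card_ord -(cardC (mem (c :: q))).
  by congr addn; apply: eq_card => a; rewrite !inE.
have sp2 : spine ms U c s2.
  exists q; split=> // [|a]; last by rewrite in_set negbK.
  by move: cq; rewrite /= rcons_path => /andP[].
have sp1 : spine ms U c s1.
  have cq' : cycle (adj ms) (c :: rev q).
    by rewrite -(cycle_rev (adjC ms)) rev_cons revK -rot1_cons rot_cycle.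
  exists (rev q); split.
  - by rewrite /= mem_rev rev_uniq.
  - by move: cq'; rewrite /= rcons_path => /andP[].
  - by rewrite def1; case: (q) => // b q'; rewrite rev_cons last_rcons.
  - by move=> a; rewrite in_set negbK !in_cons mem_rev.
have fr : frame s1 s2 c U.
  split; first exact: spine_head sp1.
    by case.
  by move=> s [] ->; [apply: spine_last sp1|apply: spine_last sp2].
have U11 : 11 <= #|U| by lia.
have win_U : win s1 s2 (adj bs) x c U.
  apply: (wins_upto3 s12 (D := [set a in D] :&: U) (z := z)) U11.
  - split=> //.
    + by move=> a b; rewrite adjC.
    + by move=> a b; rewrite !inE; apply: UU.
    + move=> u s uU es us; rewrite in_setI uU andbT inE.
      apply: dirt; first by move: uU; rewrite inE.
      by case: es us => -> ->; rewrite ?orbT.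
    + by move=> d /setIP[].
  - by split=> // u; rewrite inE; apply: Nz.
  - apply: leq_trans (subset_leq_card (subsetIl _ _)) _.
    by rewrite cardsE; apply: leq_trans (card_size _) D3.
have [k Uk] : exists k, #|U| = k.+1 by case: #|U| U11 => // k _; exists k.
have -> : n + 6 - size ms = k.+1 + 6 by lia.
by move: win_U; rewrite /win Uk; apply: (wins_of_force n_big st).
Qed.

Lemma edge_cases bs x y a b : adj (rcons bs (x, y)) a b ->
  [\/ adj bs a b, a = x /\ b = y | a = y /\ b = x].
Proof. by case/adj_add=> [|[]]; [constructor 1|constructor 2|constructor 3]. Qed.

Lemma fresh (l : seq 'I_n) : size l < n -> exists a, a \notin l.
Proof.
move=> ln; have [|a] := @pick_ord _ [set a in l].
  by apply: leq_ltn_trans ln; rewrite cardsE card_size.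
by rewrite inE; exists a.
Qed.

Ltac edges := repeat match goal with
  | H : is_true (adj (rcons _ (_, _)) _ _) |- _ => case/edge_cases: H => [H|[? ?]|[? ?]]
  | H : is_true (adj [::] _ _) |- _ => by rewrite adj_nil in H
  end.

Ltac own := by rewrite !adj_rcons !eqxx ?orbT.

#[local] Arguments rcons : simpl never.

Lemma wins_first t : 2 < n ->
  (forall x y c, x <> y -> c <> x -> c <> y ->
     stands (rcons [::] (x, y)) (rcons [::] (c, y)) y y ->
     wins t (rcons [::] (x, y)) (rcons [::] (c, y))) ->
  @wins n t.+1 [::] [::].
Proof.
move=> n2 step; right=> -[x y] /and3P[_ xy _].
have [|c] := @fresh [:: x; y]; first exact: n2.
rewrite !inE negb_or => /andP[cx cy].
have free a b : adj (rcons [::] (c, y)) a b -> ~~ adj (rcons [::] (x, y)) a b.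
  move/eqP: xy; move/eqP: cx; move/eqP: cy => *.
  by apply/negP => ?; edges; congruence.
exists (c, y); first by rewrite /legal /= cy; apply: free; own.
apply: step; try exact/eqP.
by split=> //; split=> //; apply: walk_rcons => //; constructor.
Qed.

Ltac neqs H := rewrite !(inE, negb_or) in H;
  repeat (let H' := fresh in case/andP: H => /eqP H' H); move/eqP in H.

Ltac uniqs := rewrite /= !(inE, negb_or);
  repeat (apply/andP; split); try (apply/eqP; congruence).

Ltac cycles := rewrite /=; repeat (apply/andP; split); first [own | done].

(* c is new and x1 is the position of WBreaker, so his first edge x0 x1 has a      *)
(* visited end.  He can hinder WMaker from closing the cycle only by moving to c   *)
(* while she stands at the end of the edge z c that he claims thereby.             *)
Lemma wins_opening : 400 <= n -> @wins n (n + 6) [::] [::].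
Proof.
move=> n_big; rewrite (_ : n + 6 = n.+3.+3); last by lia.
have new (l : seq 'I_n) : size l < 10 -> exists a, a \notin l.
  by move=> l10; apply: fresh; lia.
apply: wins_first => [|x0 x1 c x01 cx0 cx1 st1]; first exact: leq_trans n_big.
apply: (wins_step st1) => y yx1 /negP my.
have yc : y <> c by move=> ?; subst; apply: my; rewrite adjC; own.
have [//|a aN] := new [:: c; x0; x1; y]; neqs aN.
exists a; split=> // [e|st2]; first by edges; congruence.
apply: (wins_step st2) => z zy /negP mz.
have [zvis|zN] := boolP (z \in [:: c; x1; a]).
  have zc : [\/ z = c, z = x1 | z = a].
    by move: zvis; rewrite !inE => /or3P[] /eqP; [constructor 1|constructor 2|constructor 3].
  exists c; split=> [|e|st3]; [exact/nesym|by edges; congruence|].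
  apply: wins_mono (wins_lollipop (q := [:: x1; a]) (D := [:: x0; y])
    (z := if z == c then y else z) n_big _ st3 _ _ _ erefl erefl _ _ _ _ _ _ _ _) => //=.
  - by lia.
  - by uniqs.
  - by cycles.
  - by congruence.
  - by congruence.
  - by move=> u w uN wN e; neqs uN; neqs wN; case: zc => ?; edges; congruence.
  - move=> u uN e; neqs uN; suff: u = x0 \/ u = y.
      by rewrite !inE => -[] ->; rewrite eqxx ?orbT.
    by case/orP: e => e; case: zc => ?; edges; intuition congruence.
  - by move=> u uN e; neqs uN; case: eqP => ?; edges; congruence.
  - by case: eqP; auto.
neqs zN; exists z; split=> [|e|st3]; [by congruence|by edges; congruence|].
apply: (wins_step st3) => t tz /negP mt.
have ta : t <> a by move=> ?; subst; apply: mt; rewrite adjC; own.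
have [tc|/eqP tc] := eqVneq t c; last first.
  exists c; split=> [|e|st4]; [by congruence|by edges; congruence|].
  apply: wins_mono (wins_lollipop (q := [:: x1; a; z]) (D := [:: x0; y; t])
    (z := t) n_big _ st4 _ _ _ erefl erefl _ _ _ _ _ _ _ _) => //=.
  - by lia.
  - by uniqs.
  - by cycles.
  - by congruence.
  - by congruence.
  - by move=> u w uN wN e; neqs uN; neqs wN; edges; congruence.
  - move=> u uN e; neqs uN; suff: [\/ u = x0, u = y | u = t].
      by rewrite !inE => -[] ->; rewrite eqxx ?orbT.
    by case/orP: e => e; edges; first [constructor 1; congruence
      | constructor 2; congruence | constructor 3; congruence | congruence].
  - by move=> u uN e; neqs uN; edges; congruence.
  - by right.
subst t; have [//|r rN] := new [:: c; x0; x1; y; a; z]; neqs rN.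
exists r; split=> [|e|st4]; [by congruence|by edges; congruence|].
apply: (wins_step st4) => q qc /negP mq.
have qx1 : q <> x1 by move=> ?; subst; apply: mq; own.
have [qr|/eqP qr] := eqVneq q r; last first.
  exists c; split=> [|e|st5]; [by congruence|by edges; congruence|].
  apply: wins_mono (wins_lollipop (q := [:: x1; a; z; r]) (D := [:: x0; y])
    (z := q) n_big _ st5 _ _ _ erefl erefl _ _ _ _ _ _ _ _) => //=.
  - by lia.
  - by uniqs.
  - by cycles.
  - by congruence.
  - by congruence.
  - by move=> u w uN wN e; neqs uN; neqs wN; edges; congruence.
  - move=> u uN e; neqs uN; suff: u = x0 \/ u = y.
      by rewrite !inE => -[] ->; rewrite eqxx ?orbT.
    by case/orP: e => e; edges; intuition congruence.
  - by move=> u uN e; neqs uN; edges; congruence.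
  - by right.
subst q; have [//|r' rN'] := new [:: c; x0; x1; y; a; z; r]; neqs rN'.
exists r'; split=> [|e|st5]; [by congruence|by edges; congruence|].
apply: (wins_step st5) => q qr /negP mq'.
have qr' : q <> r' by move=> ?; subst; apply: mq'; own.
exists c; split=> [|e|st6]; [by congruence|by edges; congruence|].
apply: wins_mono (wins_lollipop (q := [:: x1; a; z; r; r']) (D := [:: x0; y])
  (z := q) n_big _ st6 _ _ _ erefl erefl _ _ _ _ _ _ _ _) => //=.
- by lia.
- by uniqs.
- by cycles.
- by congruence.
- by congruence.
- by move=> u w uN wN e; neqs uN; neqs wN; edges; congruence.
- move=> u uN e; neqs uN; suff: u = x0 \/ u = y.
    by rewrite !inE => -[] ->; rewrite eqxx ?orbT.
  by case/orP: e => e; edges; intuition congruence.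
- by move=> u uN e; neqs uN; edges; congruence.
- by right.
Qed.

End Opening.

Theorem theorem2 :
  exists n0 : nat, forall n : nat, n0 <= n ->
    exists S : strategy n, legal_strategy S /\ wins_within S (n + 6).
Proof.
exists 400 => n n_big; apply: strategy_of_wins; last exact: wins_opening.
exact: leq_trans n_big.
Qed.
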